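(* Let $\mathcal{A}$ be a $C^*$-algebra and assume that $\mathcal{A}$ is acting isometrically and non-degenerately on a Banach space $\mathfrak{X}$. Then the mapping $$\mathbf{LM}_{\mathfrak{X}}(\mathcal{A}) \longrightarrow \mathbf{LC}(\mathcal{A}), \qquad b \longmapsto L_b,$$ establishes an isometric Banach algebra isomorphism between $\mathbf{LM}_{\mathfrak{X}}(\mathcal{A})$ and $\mathbf{LC}(\mathcal{A})$.
   Context: $B(\mathfrak{X})$ denotes the bounded linear operators on the Banach space $\mathfrak{X}$. That $\mathcal{A}$ acts isometrically on $\mathfrak{X}$ means that there is an isometric algebra homomorphism $\mathcal{A}\to B(\mathfrak{X})$, through which $\mathcal{A}$ is identified with a norm-closed subalgebra of $B(\mathfrak{X})$; the action is non-degenerate if the linear span of $\{ax \mid a\in\mathcal{A},\ x\in\mathfrak{X}\}$ is dense in $\mathfrak{X}$. For a norm-closed subalgebra $\mathfrak{A}$ of $B(\mathfrak{X})$, the left multiplier algebra of $\mathfrak{A}$ is $\mathbf{LM}_{\mathfrak{X}}(\mathfrak{A}) = \{ b\in B(\mathfrak{X}) \mid ba\in\mathfrak{A} \text{ for all } a\in\mathfrak{A}\}$, with the norm of $B(\mathfrak{X})$. For $b\in \mathbf{LM}_{\mathfrak{X}}(\mathfrak{A})$, $L_b\in B(\mathfrak{A})$ is the left multiplication operator $L_b(a)=ba$. For a Banach algebra $\mathfrak{A}$, a left centralizer is a bounded linear map $\Phi:\mathfrak{A}\to\mathfrak{A}$ with $\Phi(ab)=\Phi(a)b$ for all $a,b\in\mathfrak{A}$;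 $\mathbf{LC}(\mathfrak{A})$ is the algebra (under composition) of all left centralizers of $\mathfrak{A}$, equipped with the supremum (operator) norm. *)

(* Defs.v *)
From HB Require Import structures.
From mathcomp Require Import all_boot all_order all_algebra.
From mathcomp Require Import complex.
From mathcomp Require Import boolp classical_sets functions reals topology.
From mathcomp Require Import normedtype.

Set Implicit Arguments.
Unset Strict Implicit.
Unset Printing Implicit Defensive.

Import Order.TTheory GRing.Theory Num.Theory.
Import numFieldNormedType.Exports.

Local Open Scope classical_set_scope.
Local Open Scope ring_scope.
Local Open Scope complex_scope.

Reserved Notation "x ** y" (at level 40, left associativity).

(** Banach algebras and C*-algebras are complex and need not have a unit, so
    their product is not the one of MathComp's (unital) [algType]. *)

HB.mixin Record isBanachAlgebra (R : realType) A
    & CompleteNormedModule R[i] A := {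
  bmul : A -> A -> A;
  bmulA : associative bmul;
  bmulDl : left_distributive bmul +%R;
  bmulDr : right_distributive bmul +%R;
  bmulZl : forall (k : R[i]) (a b : A), bmul (k *: a) b = k *: bmul a b;
  bmulZr : forall (k : R[i]) (a b : A), bmul a (k *: b) = k *: bmul a b;
  norm_bmul : forall a b : A, `|bmul a b| <= `|a| * `|b|
}.

#[short(type="banachAlgType")]
HB.structure Definition BanachAlgebra (R : realType) :=
  {A of isBanachAlgebra R A & CompleteNormedModule R[i] A}.

Notation "x ** y" := (bmul x y) : ring_scope.

HB.mixin Record isCstarAlgebra (R : realType) A & BanachAlgebra R A := {
  star : A -> A;
  starK : involutive star;
  starD : {morph star : a b / a + b};
  starZ : forall (k : R[i]) (a : A), star (k *: a) = k^* *: star a;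
  starM : forall a b : A, star (a ** b) = star b ** star a;
  norm_star : forall a : A, `|star a ** a| = `|a| ^+ 2
}.

#[short(type="cstarAlgType")]
HB.structure Definition CstarAlgebra (R : realType) :=
  {A of isCstarAlgebra R A & BanachAlgebra R A}.

Record isometric_banach_alg_iso (R : realType) (U V : banachAlgType R)
    (f : U -> V) : Prop := {
  iso_linear : linear f;
  iso_mul : {morph f : x y / x ** y};
  iso_norm : forall x, `|f x| = `|x|;
  iso_bij : bijective f
}.

Section NormRe.
Context {R : realType}.

Lemma ge0_ReE (z : R[i]) : 0 <= z -> z = (complex.Re z)%:C.
Proof. by case: z => a b; rewrite lecE /= => /andP[/eqP -> _]. Qed.

Lemma ge0_Re (z : R[i]) : 0 <= z -> 0 <= complex.Re z.
Proof. by case: z => a b; rewrite lecE /= => /andP[]. Qed.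

Lemma le_Re (z t : R[i]) : z <= t -> complex.Re z <= complex.Re t.
Proof. by rewrite lecE => /andP[]. Qed.

Lemma lipschitz_cont (V W : normedModType R[i]) (h : V -> W) (M : R[i]) :
  0 <= M -> (forall x y, `|h x - h y| <= M * `|x - y|) -> continuous h.
Proof.
move=> M0 hM x; apply/cvgrPdist_lt => e e0.
have M1 : 0 < M + 1 by rewrite ltr_wpDl.
have eM : 0 < e / (M + 1) by rewrite divr_gt0.
near=> y.
have xy : `|x - y| < e / (M + 1) by near: y; exact: cvgr_dist_lt.
apply: (@le_lt_trans _ _ ((M + 1) * `|x - y|)).
  by apply: (le_trans (hM _ _)); rewrite ler_wpM2r// lerDl.
by rewrite mulrC -ltr_pdivlMr.
Unshelve. all: by end_near. Qed.

End NormRe.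

Section BoundedOperators.
Context {R : realType} (X : completeNormedModType R[i]).

Definition bounded_linear (f : X -> X) : Prop :=
  linear f /\ exists M : R[i], forall x, `|f x| <= M * `|x|.

Definition bounded_linear_pred : {pred X -> X} :=
  fun f => `[< bounded_linear f >].

Record boundedOp := BoundedOp {
  bop_fun :> X -> X;
  _ : bop_fun \in bounded_linear_pred
}.

HB.instance Definition _ := [isSub for bop_fun].
HB.instance Definition _ := [Choice of boundedOp by <:].

Lemma bounded_linear_ge0 f : bounded_linear f ->
  exists2 M : R[i], 0 <= M & forall x, `|f x| <= M * `|x|.
Proof.
move=> [_ [M fM]]; exists `|M| => // x.
have := le_trans (normr_ge0 _) (fM x) => /ger0_norm.
by rewrite normrM normr_id => ->.
Qed.

Fact bounded_linear_submod_closed : subsemimod_closed bounded_linear_pred.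
Proof.
split; first split.
- apply/asboolP; split; first by move=> k x y; rewrite /= scaler0 addr0.
  by exists 0 => x; rewrite mul0r normr0.
- move=> f g /asboolP fb /asboolP gb; apply/asboolP.
  have [M M0 fM] := bounded_linear_ge0 fb.
  have [N N0 gN] := bounded_linear_ge0 gb.
  split.
    move=> k x y.
    change (f (k *: x + y) + g (k *: x + y) = k *: (f x + g x) + (f y + g y)).
    by rewrite (proj1 fb) (proj1 gb) scalerDr addrACA.
  exists (M + N) => x; rewrite mulrDl; apply: le_trans (ler_normD _ _) _.
  exact: lerD.
- move=> k f /asboolP fb; apply/asboolP.
  have [M M0 fM] := bounded_linear_ge0 fb.
  split.
    move=> l x y.
    change (k *: f (l *: x + y) = l *: (k *: f x) + k *: f y).
    by rewrite (proj1 fb) scalerDr !scalerA mulrC.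
  by exists (`|k| * M) => x; rewrite [(k *: f) x]/(k *: f x) normrZ -mulrA ler_wpM2l.
Qed.

HB.instance Definition _ := GRing.isSubmodClosed.Build R[i] (X -> X)
  bounded_linear_pred bounded_linear_submod_closed.
HB.instance Definition _ := [SubChoice_isSubLmodule of boundedOp by <:].

Lemma bopP (f : boundedOp) : bounded_linear f.
Proof. by case: f => f /= /asboolP. Qed.

Lemma bop_linear (f : boundedOp) : linear f.
Proof. by have [] := bopP f. Qed.

Lemma bop_ext (f g : boundedOp) : f =1 g -> f = g.
Proof. by move=> fg; apply/val_inj/funext. Qed.

Lemma bopDE (f g : boundedOp) x : (f + g) x = f x + g x.
Proof. by []. Qed.

Lemma bopZE k (f : boundedOp) x : (k *: f) x = k *: f x.
Proof. by []. Qed.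

Lemma bopNE (f : boundedOp) x : (- f) x = - f x.
Proof. by []. Qed.

Lemma bop0 (f : boundedOp) : f 0 = 0.
Proof. by have := bop_linear f (-1) 0 0; rewrite scaler0 addr0 scaleN1r addNr. Qed.

Lemma bopD (f : boundedOp) x y : f (x + y) = f x + f y.
Proof. by rewrite -[x]scale1r bop_linear !scale1r. Qed.

Lemma bopZ (f : boundedOp) k x : f (k *: x) = k *: f x.
Proof. by rewrite -[k *: x]addr0 bop_linear bop0 addr0. Qed.

Definition opnorm_set (f : boundedOp) : set R :=
  [set complex.Re `|f x| | x in [set x : X | `|x| <= 1]].

(* Norms of vectors are elements of R[i] (with zero imaginary part), and
   suprema are taken in R: hence Re and %:C. *)
Definition opnorm (f : boundedOp) : R[i] := (sup (opnorm_set f))%:C.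

Fact opnorm_set_has_sup f : has_sup (opnorm_set f).
Proof.
split; first by exists (complex.Re `|f 0|); exists 0 => //=; rewrite normr0.
have [M M0 fM] := bounded_linear_ge0 (bopP f).
exists (complex.Re M) => _ [x /= x1 <-]; apply: le_Re.
by apply: le_trans (fM x) _; rewrite ler_piMr.
Qed.

Lemma opnorm_ge0 (f : boundedOp) : 0 <= opnorm f.
Proof.
rewrite /opnorm lecR; apply: le_trans (ge0_Re (normr_ge0 (f 0))) _.
apply: (ub_le_sup (proj2 (opnorm_set_has_sup f))).
by exists 0 => //=; rewrite normr0.
Qed.

Lemma opnorm_ub (f : boundedOp) (x : X) : `|f x| <= opnorm f * `|x|.
Proof.
have [->|x0] := eqVneq x 0; first by rewrite bop0 !normr0 mulr0.
have nx : 0 < `|x| by rewrite normr_gt0.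
rewrite -ler_pdivrMr// mulrC.
have -> : `|x|^-1 * `|f x| = `|f (`|x|^-1 *: x)|.
  by rewrite bopZ normrZ normfV normr_id.
rewrite [leLHS]ge0_ReE ?normr_ge0// lecR.
apply: (ub_le_sup (proj2 (opnorm_set_has_sup f))).
by exists (`|x|^-1 *: x) => //=; rewrite normrZ normfV normr_id mulVf ?gt_eqF.
Qed.

Lemma opnorm_le (f : boundedOp) (M : R[i]) : 0 <= M -> (forall x, `|f x| <= M * `|x|) ->
  opnorm f <= M.
Proof.
move=> M0 fM; rewrite [leRHS]ge0_ReE// lecR.
apply: ge_sup; first exact: (proj1 (opnorm_set_has_sup f)).
move=> _ [x /= x1 <-]; apply: le_Re.
by apply: le_trans (fM x) _; rewrite ler_piMr.
Qed.

Lemma opnormD (f : boundedOp) (g : boundedOp) : opnorm (f + g) <= opnorm f + opnorm g.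
Proof.
apply: opnorm_le; first by rewrite addr_ge0 ?opnorm_ge0.
move=> x; rewrite bopDE mulrDl; apply: le_trans (ler_normD _ _) _.
by apply: lerD; exact: opnorm_ub.
Qed.

Lemma opnormZ (k : R[i]) (f : boundedOp) : opnorm (k *: f) = `|k| * opnorm f.
Proof.
have H l g : opnorm (l *: g) <= `|l| * opnorm g.
  apply: opnorm_le; first by rewrite mulr_ge0 ?opnorm_ge0.
  by move=> x; rewrite bopZE normrZ -mulrA ler_wpM2l ?opnorm_ub.
apply/le_anti/andP; split; first exact: H.
have [->|k0] := eqVneq k 0; first by rewrite normr0 mul0r opnorm_ge0.
rewrite -ler_pdivlMl ?normr_gt0// -normfV.
by apply: le_trans (H _ _); rewrite scalerA mulVf// scale1r.
Qed.

Lemma opnorm_eq0 (f : boundedOp) : opnorm f = 0 -> f = 0.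
Proof.
move=> f0; apply: bop_ext => x; apply/eqP; rewrite -normr_le0.
by have := opnorm_ub f x; rewrite f0 mul0r.
Qed.

HB.instance Definition _ := Lmodule_isNormed.Build R[i] boundedOp
  opnormD opnormZ opnorm_eq0.

Lemma bop_normE (f : boundedOp) : `|f| = opnorm f.
Proof. by []. Qed.

Lemma bop_norm_ub (f : boundedOp) x : `|f x| <= `|f| * `|x|.
Proof. exact: opnorm_ub. Qed.

Lemma bop_norm_le (f : boundedOp) (M : R[i]) : 0 <= M ->
  (forall x, `|f x| <= M * `|x|) -> `|f| <= M.
Proof. exact: opnorm_le. Qed.

Lemma bop_eval_continuous x : continuous (fun f : boundedOp => f x).
Proof.
apply: (@lipschitz_cont _ _ _ _ `|x|) => // f g.
by rewrite mulrC; exact: (bop_norm_ub (f - g)).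
Qed.

Fact bop_complete (F : set_system boundedOp) :
  ProperFilter F -> cauchy F -> cvg F.
Proof.
move=> FF /cauchy_ballP Fc.
have Fx x : cvg ((fun f : boundedOp => f x) @ F).
  apply/cauchy_cvgP/cauchy_ballP => e e0.
  rewrite near_map2.
  have x1 : 0 < `|x| + 1 by rewrite ltr_wpDl.
  have ex : 0 < e / (`|x| + 1) by rewrite divr_gt0.
  apply: filterS (Fc _ ex) => -[f g] /=; rewrite -!ball_normE /= => fg.
  apply: le_lt_trans (bop_norm_ub (f - g) x) _.
  apply: (@le_lt_trans _ _ (`|f - g| * (`|x| + 1))).
    by rewrite ler_wpM2l// lerDl.
  by rewrite -ltr_pdivlMr.
pose G x := lim ((fun f : boundedOp => f x) @ F).
have GE x : (fun f : boundedOp => f x) @ F --> G x by exact: Fx.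
have Glin : linear G.
  move=> k x y; apply: (cvg_unique (@norm_hausdorff _ X) (GE (k *: x + y))).
  rewrite /=.
  have -> : (fun f : boundedOp => f (k *: x + y)) =
            (fun f : boundedOp => k *: f x + f y).
    by apply/funext => f; rewrite bop_linear.
  by apply: cvgD; [exact: cvgZr|].
have Gu (e : R[i]) : 0 < e ->
    \forall f \near F, forall x, `|(f : boundedOp) x - G x| <= e * `|x|.
  move=> e0; near=> f => x.
  apply/ler_addgt0Pr => d d0; near F => h.
  rewrite -[f x](subrK (h x)) -addrA; apply: le_trans (ler_normD _ _) _.
  apply: lerD; last first.
    apply: ltW; rewrite distrC; near: h.
    by apply: (@cvgr_dist_lt _ _ _ _ _ _ _ (GE x)).
  apply: le_trans (bop_norm_ub (f - h) x) _; rewrite ler_wpM2r// ltW//.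
  suff : ball f e h by rewrite -ball_normE.
  near: h; near: f; apply: nearP_dep; exact: Fc.
have Gb : bounded_linear G.
  split=> //; have := Gu 1 ltr01 => /filter_ex[f fG].
  exists (`|f| + 1) => x; rewrite -[G x](subKr (f x)) mulrDl.
  by apply: le_trans (ler_normB _ _) _; apply: lerD => //; exact: bop_norm_ub.
have {}Gb : G \in bounded_linear_pred by exact/asboolP.
apply/cvg_ex; exists (BoundedOp Gb).
apply/cvgrPdist_le => e e0; near=> f.
rewrite distrC; apply: bop_norm_le; first exact: ltW.
by near: f; exact: Gu.
Unshelve. all: by end_near. Qed.

HB.instance Definition _ := Uniform_isComplete.Build boundedOp bop_complete.

Fact comp_bounded (f g : boundedOp) : f \o g \in bounded_linear_pred.
Proof.
apply/asboolP; split; first by move=> k x y /=; rewrite !bop_linear.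
exists (`|f| * `|g|) => x /=; apply: le_trans (bop_norm_ub _ _) _.
by rewrite -mulrA ler_wpM2l// bop_norm_ub.
Qed.

Definition bop_comp (f g : boundedOp) := BoundedOp (comp_bounded f g).

Fact bop_compA : associative bop_comp.
Proof. by move=> f g h; exact: bop_ext. Qed.

Fact bop_compDl : left_distributive bop_comp +%R.
Proof. by move=> f g h; exact: bop_ext. Qed.

Fact bop_compDr : right_distributive bop_comp +%R.
Proof. by move=> f g h; apply: bop_ext => x; exact: bopD. Qed.

Fact bop_compZl (k : R[i]) (f g : boundedOp) :
  bop_comp (k *: f) g = k *: bop_comp f g.
Proof. exact: bop_ext. Qed.

Fact bop_compZr (k : R[i]) (f g : boundedOp) :
  bop_comp f (k *: g) = k *: bop_comp f g.
Proof. by apply: bop_ext => x; exact: bopZ. Qed.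

Fact norm_bop_comp (f g : boundedOp) : `|bop_comp f g| <= `|f| * `|g|.
Proof.
apply: bop_norm_le => [|x]; first exact: mulr_ge0.
apply: le_trans (bop_norm_ub f (g x)) _.
by rewrite -mulrA ler_wpM2l// bop_norm_ub.
Qed.

HB.instance Definition _ := isBanachAlgebra.Build R boundedOp
  bop_compA bop_compDl bop_compDr bop_compZl bop_compZr norm_bop_comp.

Lemma bop_mulE (f g : boundedOp) x : (f ** g) x = f (g x).
Proof. by []. Qed.

End BoundedOperators.

Arguments bounded_linear_pred {R} X.

Section BanachAlgebraTheory.
Context {R : realType} (E : banachAlgType R).
Implicit Types a b c : E.

Lemma bmulBl a b c : (a - b) ** c = a ** c - b ** c.
Proof. by rewrite bmulDl -[- b]scaleN1r bmulZl scaleN1r. Qed.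

Lemma bmulBr a b c : a ** (b - c) = a ** b - a ** c.
Proof. by rewrite bmulDr -[- c]scaleN1r bmulZr scaleN1r. Qed.

Lemma bmul0r c : 0 ** c = 0.
Proof. by have := bmulBl 0 0 c; rewrite !subrr. Qed.

Lemma bmulr0 c : c ** 0 = 0.
Proof. by have := bmulBr c 0 0; rewrite !subrr. Qed.

Lemma bmulr_continuous c : continuous (fun a => a ** c).
Proof.
apply: (@lipschitz_cont _ _ _ _ `|c|) => // a b.
by rewrite -bmulBl mulrC norm_bmul.
Qed.

Lemma bmull_continuous c : continuous (fun a => c ** a).
Proof.
apply: (@lipschitz_cont _ _ _ _ `|c|) => // a b.
by rewrite -bmulBr norm_bmul.
Qed.

End BanachAlgebraTheory.

Record closedSubalg (R : realType) (E : banachAlgType R) := ClosedSubalg {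
  csa_set : set E;
  csa0 : csa_set 0;
  csa_lin : forall (k : R[i]) (a b : E),
    csa_set a -> csa_set b -> csa_set (k *: a + b);
  csa_mul : forall a b : E, csa_set a -> csa_set b -> csa_set (a ** b);
  csa_closed : closed csa_set
}.

Section ClosedSubalgebra.
Context {R : realType} {E : banachAlgType R} (S : closedSubalg E).

Definition csa_pred : {pred E} := fun a => `[< csa_set S a >].

Record csaType := CsaType {
  csa_val :> E;
  _ : csa_val \in csa_pred
}.

HB.instance Definition _ := [isSub for csa_val].
HB.instance Definition _ := [Choice of csaType by <:].

Fact csa_submod_closed : subsemimod_closed csa_pred.
Proof.
split; first split.
- by apply/asboolP; exact: csa0.
- move=> a b /asboolP Sa /asboolP Sb; apply/asboolP.
  by rewrite -[a]scale1r; exact: csa_lin.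
- move=> k a /asboolP Sa; apply/asboolP.
  by rewrite -[k *: a]addr0; apply: csa_lin => //; exact: csa0.
Qed.

HB.instance Definition _ := GRing.isSubmodClosed.Build R[i] E
  csa_pred csa_submod_closed.
HB.instance Definition _ := [SubChoice_isSubLmodule of csaType by <:].

Lemma csaP (a : csaType) : csa_set S (csa_val a).
Proof. by case: a => a /= /asboolP. Qed.

Fact csa_memP a : csa_set S a -> a \in csa_pred.
Proof. by move=> Sa; apply/asboolP. Qed.

Definition csa_elt a (Sa : csa_set S a) : csaType := CsaType (csa_memP Sa).

Lemma csa_ext (a b : csaType) : csa_val a = csa_val b -> a = b.
Proof. exact: val_inj. Qed.

Definition csa_norm (a : csaType) : R[i] := `|csa_val a|.

Fact csa_normD (a b : csaType) : csa_norm (a + b) <= csa_norm a + csa_norm b.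
Proof. exact: ler_normD. Qed.

Fact csa_normZ (k : R[i]) (a : csaType) : csa_norm (k *: a) = `|k| * csa_norm a.
Proof. exact: normrZ. Qed.

Fact csa_norm_eq0 (a : csaType) : csa_norm a = 0 -> a = 0.
Proof. by move=> /eqP; rewrite normr_eq0 => /eqP a0; exact: csa_ext. Qed.

HB.instance Definition _ := Lmodule_isNormed.Build R[i] csaType
  csa_normD csa_normZ csa_norm_eq0.

Lemma csa_normE (a : csaType) : `|a| = `|csa_val a|.
Proof. by []. Qed.

Fact csa_complete (F : set_system csaType) :
  ProperFilter F -> cauchy F -> cvg F.
Proof.
move=> FF /cauchy_ballP Fc.
have /cvg_ex[l Fl] : cvg (csa_val @ F).
  apply/cauchy_cvgP/cauchy_ballP => e e0; rewrite near_map2.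
  by apply: filterS (Fc _ e0) => -[a b] /=; rewrite -!ball_normE.
have Sl : csa_set S l.
  apply: (closed_cvg _ (@csa_closed _ _ S) _ _ Fl).
  by apply: nearW => a; exact: csaP.
apply/cvg_ex; exists (csa_elt Sl); apply/cvgrPdist_lt => e e0.
exact: (@cvgr_dist_lt _ _ _ _ _ _ _ Fl).
Qed.

HB.instance Definition _ := Uniform_isComplete.Build csaType csa_complete.

Definition csa_bmul (a b : csaType) : csaType :=
  csa_elt (csa_mul (csaP a) (csaP b)).

Fact csa_bmulA : associative csa_bmul.
Proof. by move=> a b c; apply: csa_ext; exact: bmulA. Qed.

Fact csa_bmulDl : left_distributive csa_bmul +%R.
Proof. by move=> a b c; apply: csa_ext; exact: bmulDl. Qed.

Fact csa_bmulDr : right_distributive csa_bmul +%R.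
Proof. by move=> a b c; apply: csa_ext; exact: bmulDr. Qed.

Fact csa_bmulZl (k : R[i]) (a b : csaType) :
  csa_bmul (k *: a) b = k *: csa_bmul a b.
Proof. by apply: csa_ext; exact: bmulZl. Qed.

Fact csa_bmulZr (k : R[i]) (a b : csaType) :
  csa_bmul a (k *: b) = k *: csa_bmul a b.
Proof. by apply: csa_ext; exact: bmulZr. Qed.

Fact norm_csa_bmul (a b : csaType) : `|csa_bmul a b| <= `|a| * `|b|.
Proof. exact: norm_bmul. Qed.

HB.instance Definition _ := isBanachAlgebra.Build R csaType
  csa_bmulA csa_bmulDl csa_bmulDr csa_bmulZl csa_bmulZr norm_csa_bmul.

Lemma csa_valM (a b : csaType) : csa_val (a ** b) = csa_val a ** csa_val b.
Proof. by []. Qed.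

End ClosedSubalgebra.

Coercion csaType : closedSubalg >-> Sortclass.

Section LeftMultipliers.
Context {R : realType} {X : completeNormedModType R[i]}.
Variable S : closedSubalg (boundedOp X).

Definition LM_set : set (boundedOp X) :=
  [set b | forall a, csa_set S a -> csa_set S (b ** a)].

Fact LM0 : LM_set 0.
Proof. by move=> a _; rewrite bmul0r; exact: csa0. Qed.

Fact LM_lin (k : R[i]) (b c : boundedOp X) :
  LM_set b -> LM_set c -> LM_set (k *: b + c).
Proof.
by move=> Sb Sc a Sa; rewrite bmulDl bmulZl; apply: csa_lin; [apply: Sb|apply: Sc].
Qed.

Fact LM_mul (b c : boundedOp X) : LM_set b -> LM_set c -> LM_set (b ** c).
Proof. by move=> Sb Sc a Sa; rewrite -bmulA; apply/Sb/Sc. Qed.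

Fact LM_closed : closed LM_set.
Proof.
have -> : LM_set =
    \bigcap_(a in csa_set S) ((fun b => b ** a) @^-1` csa_set S).
  by apply/seteqP; split => b; apply.
apply: closed_bigI => a _; apply: preimage_closed; last exact: csa_closed.
by move=> b _; exact: bmulr_continuous.
Qed.

Definition LM : closedSubalg (boundedOp X) :=
  ClosedSubalg LM0 LM_lin LM_mul LM_closed.

End LeftMultipliers.

Section LeftCentralizers.
Context {R : realType} (A : banachAlgType R).

Definition LC_set : set (boundedOp A) :=
  [set Phi | forall a b : A, Phi (a ** b) = Phi a ** b].

Fact LC0 : LC_set 0.
Proof. by move=> a b; rewrite [RHS]bmul0r. Qed.

Fact LC_lin (k : R[i]) (f g : boundedOp A) :
  LC_set f -> LC_set g -> LC_set (k *: f + g).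
Proof.
by move=> Sf Sg a b; rewrite !bopDE !bopZE Sf Sg bmulDl bmulZl.
Qed.

Fact LC_mul (f g : boundedOp A) : LC_set f -> LC_set g -> LC_set (f ** g).
Proof. by move=> Sf Sg a b; rewrite !bop_mulE Sg Sf. Qed.

Fact LC_closed : closed LC_set.
Proof.
have -> : LC_set =
    \bigcap_(p in [set: A * A])
      ((fun f : boundedOp A => f (p.1 ** p.2) - f p.1 ** p.2) @^-1` [set 0]).
  apply/seteqP; split => f /= Sf.
    by move=> [a b] _ /=; rewrite Sf subrr.
  by move=> a b; apply/eqP; rewrite -subr_eq0; apply/eqP; exact: (Sf (a, b)).
apply: closed_bigI => -[a b] _; apply: preimage_closed => /=; last first.
  exact/accessible_closed_set1/hausdorff_accessible/norm_hausdorff.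
move=> f _.
have h1 : (fun g : boundedOp A => g (a ** b)) @ f --> f (a ** b).
  exact: bop_eval_continuous.
have h0 : (fun g : boundedOp A => g a) @ f --> f a.
  exact: bop_eval_continuous.
have h2 : (fun g : boundedOp A => g a ** b) @ f --> f a ** b.
  apply: (@cvg_comp _ _ _ (fun g : boundedOp A => g a) (fun c : A => c ** b)
            (nbhs f) (nbhs (f a)) (nbhs (f a ** b)) h0).
  exact: bmulr_continuous.
exact: (cvgB h1 h2).
Qed.

Definition LC : closedSubalg (boundedOp A) :=
  ClosedSubalg LC0 LC_lin LC_mul LC_closed.

End LeftCentralizers.

Record isometricAction (R : realType) (A : banachAlgType R)
    (X : completeNormedModType R[i]) := IsometricAction {
  act :> A -> boundedOp X;
  act_linear : linear act;
  act_mul : {morph act : a b / a ** b};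
  act_norm : forall a, `|act a| = `|a|
}.

Section Actions.
Context {R : realType} {A : banachAlgType R} {X : completeNormedModType R[i]}.
Variable pi : isometricAction A X.

Definition nondegenerate_action : Prop :=
  dense [set y : X | exists (n : nat) (a : 'I_n -> A) (x : 'I_n -> X),
    y = \sum_(i < n) pi (a i) (x i)].

Lemma act0 : pi 0 = 0.
Proof.
by have := act_linear pi (-1) 0 0; rewrite scaler0 addr0 scaleN1r addNr.
Qed.

Lemma actB a b : pi (a - b) = pi a - pi b.
Proof.
by rewrite addrC -scaleN1r act_linear scaleN1r addrC.
Qed.

Lemma act_inj : injective pi.
Proof.
move=> a b ab; apply/eqP; rewrite -subr_eq0 -normr_eq0 -(act_norm pi).
by rewrite actB ab subrr normr0.
Qed.

Fact act_range0 : range pi 0.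
Proof. by exists 0 => //; exact: act0. Qed.

Fact act_range_lin (k : R[i]) (b c : boundedOp X) :
  range pi b -> range pi c -> range pi (k *: b + c).
Proof.
by move=> [a _ <-] [a' _ <-]; exists (k *: a + a') => //; exact: act_linear.
Qed.

Fact act_range_mul (b c : boundedOp X) :
  range pi b -> range pi c -> range pi (b ** c).
Proof.
by move=> [a _ <-] [a' _ <-]; exists (a ** a') => //; exact: act_mul.
Qed.

Fact act_range_closed : closed (range pi).
Proof.
move=> b cb.
pose F := filter_from (nbhs b) (fun U => pi @^-1` U).
have FF : ProperFilter F.
  apply: filter_from_proper.
    apply: filter_from_filter; first by exists setT; exact: filterT.
    by move=> U V bU bV; exists (U `&` V) => //; exact: filterI.
  by move=> U /cb[_ [[a _ <-] Ua]]; exists a.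
have piF : pi @ F --> b by move=> U bU; exists U.
have /cvg_ex[a Fa] : cvg F.
  apply/cauchy_cvgP/cauchy_ballP => e e0.
  have : cauchy (pi @ F) by apply: cvg_cauchy; apply/cvg_ex; exists b.
  move=> /cauchy_ballP/(_ e e0); rewrite near_map2.
  apply: filterS => -[x y] /=; rewrite -!ball_normE /=.
  by rewrite -actB (act_norm pi).
exists a => //.
have picont : continuous pi.
  by apply: (@lipschitz_cont _ _ _ _ 1) => // x y; rewrite -actB (act_norm pi) mul1r.
apply: (cvg_unique (@norm_hausdorff _ (boundedOp X)) _ piF).
by move=> U /picont/Fa.
Qed.

(* The norm-closed subalgebra of B(X) with which A is identified. *)
Definition act_range : closedSubalg (boundedOp X) :=
  ClosedSubalg act_range0 act_range_lin act_range_mul act_range_closed.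

Fact leftMul_subproof (b : LM act_range) (a : A) :
  exists c : A, pi c = csa_val b ** pi a.
Proof.
have bLM : LM_set act_range (csa_val b) := csaP b.
have [|c _ <-] := bLM (pi a); first by exists a.
by exists c.
Qed.

Definition leftMul_fun (b : LM act_range) (a : A) : A :=
  sval (cid (leftMul_subproof b a)).

Lemma leftMul_funE b a : pi (leftMul_fun b a) = csa_val b ** pi a.
Proof. exact: svalP (cid (leftMul_subproof b a)). Qed.

Fact leftMul_bounded b : leftMul_fun b \in bounded_linear_pred A.
Proof.
apply/asboolP; split.
  move=> k x y; apply: act_inj.
  by rewrite act_linear !leftMul_funE act_linear bmulDr bmulZr.
exists `|csa_val b| => a.
by rewrite -(act_norm pi) leftMul_funE -(act_norm pi a) norm_bmul.
Qed.

Fact leftMul_LC b : csa_set (LC A) (BoundedOp (leftMul_bounded b)).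
Proof.
by move=> x y; apply: act_inj => /=; rewrite act_mul !leftMul_funE act_mul bmulA.
Qed.

(* L_b, seen as an operator on A through the identification of A with pi(A). *)
Definition leftMul (b : LM act_range) : LC A := csa_elt (leftMul_LC b).

Lemma leftMulE (b : LM act_range) (a : A) :
  pi (csa_val (leftMul b) a) = csa_val b ** pi a.
Proof. exact: leftMul_funE. Qed.

End Actions.

Arguments leftMul {R A X} pi b.

(* Main.v *)
Require Import Defs.
From mathcomp Require Import all_boot all_order all_algebra.
From mathcomp Require Import complex.
From mathcomp Require Import boolp classical_sets functions reals topology.
From mathcomp Require Import normedtype sequences.
From mathcomp Require Import ring.

Import Order.TTheory GRing.Theory Num.Theory.
Import numFieldNormedType.Exports.

Local Open Scope classical_set_scope.
Local Open Scope complex_scope.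
Local Open Scope ring_scope.

(** The substance is the existence in A of a left approximate unit (e) with
    |e| <= 1, that is, e ** a --> a for every a.  Once it is there:

    - injectivity: if b ** pi a = c ** pi a for all a, the bounded operators b
      and c agree on the span of the vectors pi a x, which is dense
      ([nondegenerate_ext]);
    - surjectivity: a left centralizer Phi comes from the strong limit
      b x := lim pi (Phi e) x.  On x = pi a y this net is
      pi (Phi (e ** a)) y, which tends to pi (Phi a) y; so it converges on a
      dense subspace, and everywhere because it is bounded by |Phi| |x|.  The
      limit satisfies b ** pi a = pi (Phi a) and |b| <= |Phi|
      ([left_centralizer_extension]);
    - isometry: |L_b| <= |b| holds as pi is isometric; conversely the operator
      just built from Phi = L_b has norm at most |L_b|, and is b by injectivity.
      The bound 1 on the approximate unit is what makes this sharp.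

    The approximate unit is obtained without functional calculus, order or
    positivity.  The unitization is avoided by letting its elements 1 + k act on
    A by left multiplication.  If k is skew-adjoint, the C*-identity gives
    |(1 - k) x| = |(1 + k) x| >= |x|, and 1 + k is onto by continuation along
    the multiples of k.  So the Cayley transform W = (1 - k) (1 + k)^-1 is an
    isometry, and everything below is expressed with (1 + k)^-1.

    For one element a and large t > 0 take k = i t (a ** star a): then
    (1 + k)^-1 = 1 - r with r in A, it is a contraction, and it sends a to a
    vector of norm at most t^(-1/2) ([co_contractive_single]).  Products of such
    contractions 1 - r treat finitely many elements at once
    ([co_contractive_seq]).  This yields e0 with 1 - e0 contractive, but only
    |e0| <= 2.  To reach the bound 1, put 1 - h = (1 - star e0) (1 - e0), so
    that h is self-adjoint and still almost fixes the given elements, and let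
    k = i h.  For an exact fixed vector, h a = a, one has W a = - i a, so
    W^2 a = - a and e := (1 - W^2) / 2 fixes a; and |e| <= 1 since W is
    isometric ([contractive_of_selfadjoint]). *)

(** * Complex scalars and a fixed point theorem *)

Lemma real_complex_gt0 {R : realType} (x : R) : (0 < x%:C%C) = (0 < x).
Proof. exact: (ltcR 0 x). Qed.

Lemma complex_archi {R : realType} (z : R[i]) : 0 <= z -> exists n : nat, z <= n%:R.
Proof.
move=> z0; exists (Num.truncn (complex.Re z)).+1; rewrite [z]ge0_ReE//.
have -> : (Num.truncn (complex.Re z)).+1%:R =
          ((Num.truncn (complex.Re z)).+1%:R : R)%:C by rewrite rmorph_nat.
by rewrite lecR; apply/ltW/truncnS_gt.
Qed.

(** Banach's fixed point theorem for a complex Banach space; the ratio 1/2 is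
    all that the continuation argument below asks for. *)
Lemma half_contraction_fixpoint {R : realType} {V : completeNormedModType R[i]}
    (f : V -> V) :
  (forall x y, `|f x - f y| <= 2^-1 * `|x - y|) -> exists x, f x = x.
Proof.
move=> fhalf; pose u n := iter n f 0; pose D := `|f 0|.
have step n : `|u n.+1 - u n| <= 2^-1 ^+ n * D.
  elim: n => [|n IHn]; first by rewrite /u/= subr0 expr0 mul1r.
  by apply: le_trans (fhalf _ _) _; rewrite exprS -mulrA ler_wpM2l ?invr_ge0.
have tail n j : `|u (n + j)%N - u n| <= (1 - 2^-1 ^+ j) * (2 * 2^-1 ^+ n * D).
  elim: j => [|j IHj]; first by rewrite addn0 !subrr normr0 mul0r.
  rewrite addnS -(subrKA (u (n + j)%N)).
  apply: le_trans (ler_normD _ _) _; apply: le_trans (lerD (step _) IHj) _.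
  rewrite exprD exprS; set p := 2^-1 ^+ n; set q := 2^-1 ^+ j.
  by rewrite le_eqVlt; apply/orP; left; apply/eqP; field.
have cu : cauchy (u @ \oo).
  apply: cauchy_exP => e e0.
  have D0 : 0 <= 2 * D / e.
    by apply: divr_ge0; [exact: mulr_ge0 (ler0n _ _) (normr_ge0 _)|exact: ltW].
  have [n nD] := complex_archi _ D0.
  exists (u n); exists n => // m /= nm; rewrite -ball_normE/= distrC.
  rewrite -(subnKC nm); apply: le_lt_trans (tail _ _) _.
  have p0 : 0 < 2^-1 ^+ n :> R[i] by rewrite exprn_gt0// invr_gt0.
  apply: (@le_lt_trans _ _ (2 * 2^-1 ^+ n * D)).
    rewrite ler_piMl//; last by rewrite gerBl exprn_ge0// invr_ge0.
    by rewrite mulr_ge0 ?normr_ge0// mulr_ge0// ltW.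
  rewrite mulrAC exprVn ltr_pdivrMr ?exprn_gt0// [e * _]mulrC -ltr_pdivrMr//.
  by apply: (le_lt_trans nD); rewrite -natrX ltr_nat ltn_expl.
have /cvg_ex[l ul] : cvg (u @ \oo) by exact: cauchy_cvg.
exists l; apply: (cvg_unique (@norm_hausdorff _ V) _ ul).
have fl : (fun n => u n.+1) @ \oo --> f l.
  suff fc : continuous f by exact: (cvg_comp _ _ ul (fc l)).
  by apply: (@lipschitz_cont _ _ _ _ 2^-1); rewrite ?invr_ge0.
by move: fl; rewrite (cvg_shiftS u).
Qed.

(** * Skew-adjoint perturbations of the unit *)

Section CstarAlgebra.
Context {R : realType} {A : cstarAlgType R}.
Implicit Types (a b e h k x y : A).

Lemma bmulNl a b : (- a) ** b = - (a ** b).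
Proof. by rewrite -[- a]scaleN1r bmulZl scaleN1r. Qed.

Lemma bmulNr a b : a ** (- b) = - (a ** b).
Proof. by rewrite -[- b]scaleN1r bmulZr scaleN1r. Qed.

Lemma starN a : star (- a) = - star a.
Proof. by rewrite -scaleN1r starZ rmorphN1 scaleN1r. Qed.

Lemma norm_starE a : `|star a| = `|a|.
Proof.
have H b : `|b| <= `|star b|.
  have [->|b0] := eqVneq b 0; first by rewrite normr0 normr_ge0.
  have nb : 0 < `|b| by rewrite normr_gt0.
  by rewrite -(ler_pM2r nb) -expr2 -norm_star norm_bmul.
by apply/le_anti; rewrite H -{2}[a]starK H.
Qed.

(** The left regular representation of a C*-algebra is isometric: for x = star e
    the product e ** x has norm |e|^2 by the C*-identity. *)
Lemma norm_le_lmul e (M : R[i]) :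
  0 <= M -> (forall x, `|e ** x| <= M * `|x|) -> `|e| <= M.
Proof.
move=> M0 eM; have [->|e0] := eqVneq e 0; first by rewrite normr0.
have ne : 0 < `|e| by rewrite normr_gt0.
rewrite -(ler_pM2r ne) -{3}norm_starE -expr2 -norm_starE -norm_star starK.
exact: eM.
Qed.

(** Left multiplication by the element 1 + k of the unitization of A. *)
Definition one_plus k x := x + k ** x.

Lemma one_plusE k x : one_plus k x = x + k ** x. Proof. by []. Qed.

Lemma one_plusD k x y : one_plus k (x + y) = one_plus k x + one_plus k y.
Proof. by rewrite /one_plus bmulDr addrACA. Qed.

Lemma one_plusB k x y : one_plus k (x - y) = one_plus k x - one_plus k y.
Proof. by rewrite /one_plus bmulBr addrACA opprD. Qed.

Lemma one_plus_mul k x y : one_plus k (x ** y) = one_plus k x ** y.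
Proof. by rewrite /one_plus bmulDl bmulA. Qed.

Lemma one_plus_comm k x : one_plus k (k ** x) = k ** one_plus k x.
Proof. by rewrite /one_plus bmulDr. Qed.

Definition skew k := star k = - k.

Lemma skewN k : skew k -> skew (- k).
Proof. by rewrite /skew starN => ->. Qed.

Lemma skewD k l : skew k -> skew l -> skew (k + l).
Proof. by rewrite /skew starD opprD => -> ->. Qed.

(** In the unitization star (1 + k) (1 + k) = 1 - k^2, which is even in k: by the
    C*-identity (1 + k) x and (1 - k) x then have the same norm. *)
Lemma star_one_plus k x : skew k ->
  star (one_plus k x) ** one_plus k x = star x ** x - star x ** (k ** (k ** x)).
Proof.
move=> kS; rewrite /one_plus starD starM kS bmulNr bmulDl !bmulDr !bmulNl.
by rewrite -!bmulA addrA addrK.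
Qed.

Lemma norm_one_plusN k x : skew k -> `|one_plus (- k) x| = `|one_plus k x|.
Proof.
move=> kS; apply/eqP; rewrite -(@eqrXn2 _ 2)// -!norm_star.
rewrite !star_one_plus//; last exact: skewN.
by rewrite !bmulNl !bmulNr opprK.
Qed.

Lemma one_plusN_comm k x :
  one_plus k (one_plus (- k) x) = one_plus (- k) (one_plus k x).
Proof.
by rewrite /one_plus !bmulDr !bmulNl !bmulNr !addrA subrK addrK.
Qed.

(** 2 x is the sum of (1 + k) x and (1 - k) x, which have equal norms. *)
Lemma norm_one_plus_ge k x : skew k -> `|x| <= `|one_plus k x|.
Proof.
move=> kS; rewrite -(ler_pMn2r (ltn0Sn 1)) -normrMn.
have -> : x *+ 2 = one_plus k x + one_plus (- k) x.
  by rewrite /one_plus bmulNl mulr2n addrACA subrr addr0.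
by apply: le_trans (ler_normD _ _) _; rewrite norm_one_plusN// mulr2n.
Qed.

Lemma one_plus_inj k : skew k -> injective (one_plus k).
Proof.
move=> kS x y xy; apply/eqP; rewrite -subr_eq0 -normr_le0.
by apply: le_trans (norm_one_plus_ge _ _ kS) _; rewrite one_plusB xy subrr normr0.
Qed.

(** The inverse g of 1 + k does not increase distances, so the equation
    (1 + k + d) y = c, rewritten as y = g (c - d y), is a fixed point problem
    for a contraction. *)
Lemma one_plus_surj_step k d :
  skew k -> `|d| <= 2^-1 -> (forall c, exists y, one_plus k y = c) ->
  forall c, exists y, one_plus (k + d) y = c.
Proof.
move=> kS d2 /choice[g kg] c.
have [x y|y yE] := half_contraction_fixpoint (fun y => g (c - d ** y)).
  apply: le_trans (norm_one_plus_ge _ _ kS) _.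
  rewrite one_plusB !kg opprB addrC addrA subrK -bmulBr -normrN -bmulNr opprB.
  by apply: le_trans (norm_bmul _ _) _; rewrite ler_wpM2r.
exists y; have := kg (c - d ** y); rewrite yE /one_plus => ycd.
by rewrite bmulDl addrA ycd subrK.
Qed.

(** Continuation from 0 to k in equal steps of norm at most 1/2; the previous
    lemma applies all along because every multiple of k is skew-adjoint. *)
Lemma one_plus_surj k c : skew k -> exists y, one_plus k y = c.
Proof.
move=> kS.
have [|n kn] := complex_archi (2 * `|k|); first by rewrite mulr_ge0.
have n0 : 0 < n.+1%:R :> R[i] by rewrite ltr0n.
pose d := n.+1%:R^-1 *: k.
have dS : skew d.
  by rewrite /skew starZ kS geC0_conj ?invr_ge0 ?ltW// scalerN.
have d2 : `|d| <= 2^-1.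
  rewrite normrZ normfV normr_nat ler_pdivrMl// -ler_pdivrMr ?invr_gt0//.
  by rewrite invrK mulrC (le_trans kn)// ler_nat.
have H m : skew (d *+ m) /\ forall c, exists y, one_plus (d *+ m) y = c.
  elim: m => [|m [mS mE]].
    split; first by rewrite mulr0n /skew oppr0 -[in LHS](scale0r 0) starZ conjC0 scale0r.
    by move=> {}c; exists c; rewrite /one_plus mulr0n bmul0r addr0.
  rewrite mulrSr; split; first exact: skewD.
  exact: one_plus_surj_step.
have -> : k = d *+ n.+1 by rewrite /d -scaler_nat scalerA divff ?gt_eqF ?scale1r.
exact: (H _).2.
Qed.

(** * Approximate units *)

(** A quasi-inverse: 1 - r is a right inverse of 1 + k in the unitization. *)
Lemma one_plus_resolvent k r x : one_plus k r = k -> one_plus k (x - r ** x) = x.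
Proof. by move=> kr; rewrite one_plusB one_plus_mul kr addrK. Qed.

(** The element 1 - e of the unitization acts as a contraction. Unlike the bound
    |e| <= 1, this is stable under the products (1 - a) (1 - b). *)
Definition co_contractive e := forall x, `|x - e ** x| <= `|x|.

(** With k = i t (a ** star a) and (1 + k) y = a, the vector w = star a ** y
    satisfies star w - w = 2 i t (star w ** w) and w + star w = 2 (star y ** y).
    The first gives t |w| <= 1, the second |y|^2 <= |w|. *)
Lemma co_contractive_single a (eps : R[i]) : 0 < eps ->
  exists2 r, co_contractive r & `|a - r ** a| <= eps.
Proof.
move=> eps0; pose t := eps ^- 2.
have t0 : 0 < t by rewrite invr_gt0 exprn_gt0.
pose k := ('i * t) *: (a ** star a).
have kS : skew k.
  rewrite /skew starZ rmorphM/= conjCi (geC0_conj (ltW t0)) starM starK.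
  by rewrite mulNr scaleNr.
have [r kr] := one_plus_surj k k kS.
exists r => [x|].
  by rewrite -{3}(one_plus_resolvent _ _ x kr); exact: norm_one_plus_ge.
set y := a - r ** a; pose w := star a ** y; pose v := ('i * t) *: (star w ** w).
have ya : one_plus k y = a by exact: one_plus_resolvent.
have wE : star w = star y ** y + v.
  rewrite {1}/w starM starK -[X in _ ** X]ya bmulDr; congr (_ + _).
  by rewrite bmulZl bmulZr /v /w starM starK !bmulA.
have vE : star v = - v.
  rewrite /v starZ rmorphM/= conjCi (geC0_conj (ltW t0)) starM starK.
  by rewrite mulNr scaleNr.
have w'E : w = star y ** y - v by rewrite -{1}[w]starK wE starD starM starK vE.
have yw : `|y| ^+ 2 <= `|w|.
  rewrite -(ler_pMn2r (ltn0Sn 1)) -norm_star -normrMn.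
  have -> : (star y ** y) *+ 2 = w + star w.
    by rewrite wE [X in X + _]w'E mulr2n addrACA addNr addr0.
  by apply: le_trans (ler_normD _ _) _; rewrite norm_starE mulr2n.
have tw : t * `|w| ^+ 2 <= `|w|.
  have -> : t * `|w| ^+ 2 = `|v|.
    by rewrite normrZ normrM normCi mul1r norm_star gtr0_norm.
  rewrite -(ler_pMn2r (ltn0Sn 1)) -normrMn.
  have -> : v *+ 2 = star w - w.
    by rewrite wE [X in _ - X]w'E mulr2n opprB addrC addrA subrK.
  by apply: le_trans (ler_normB _ _) _; rewrite norm_starE mulr2n.
rewrite -(@ler_pXn2r _ 2) ?nnegrE ?(ltW eps0)//; apply: (le_trans yw).
have [->|w0] := eqVneq w 0; first by rewrite normr0 ltW// exprn_gt0.
have nw : 0 < `|w| by rewrite normr_gt0.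
move: tw; rewrite expr2 mulrA ger_pMl// /t mulrC ler_pdivrMr ?exprn_gt0//.
by rewrite mul1r.
Qed.

(** The quasi-product: 1 - circ a b = (1 - a) (1 - b) in the unitization. *)
Definition circ a b := b + a - a ** b.

Lemma circE a b x : x - circ a b ** x = (x - b ** x) - a ** (x - b ** x).
Proof.
by rewrite /circ bmulBl bmulDl -bmulA bmulBr -[b ** x + _ - _]addrA opprD addrA.
Qed.

Lemma co_contractive_circ a b :
  co_contractive a -> co_contractive b -> co_contractive (circ a b).
Proof. by move=> aU bU x; rewrite circE; exact: le_trans (aU _) (bU _). Qed.

(** To add a new element a, first let 1 - e act on it, then apply a contraction
    1 - r that makes the result (1 - e) a small; the elements that 1 - e has
    already made small stay so. *)
Lemma co_contractive_seq (s : seq A) (eps : R[i]) : 0 < eps ->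
  exists2 e, co_contractive e & forall a, a \in s -> `|a - e ** a| <= eps.
Proof.
move=> eps0; elim: s => [|a s [e eU es]].
  by exists 0 => // x; rewrite bmul0r subr0.
have [r rU ra] := co_contractive_single (a - e ** a) _ eps0.
exists (circ r e); first exact: co_contractive_circ.
move=> b; rewrite inE circE => /predU1P[->//|/es]; exact: le_trans (rU _).
Qed.

Lemma co_contractive_le2 e : co_contractive e -> `|e| <= 2.
Proof.
move=> eU; apply: norm_le_lmul => // x.
have -> : e ** x = x - (x - e ** x) by rewrite subKr.
by apply: le_trans (ler_normB _ _) _; rewrite mulr_natl mulr2n lerD2l.
Qed.

(** The element is e = (1 - W^2) / 2 = 2 k (1 + k)^-2, where W is the Cayley
    transform (1 - k) (1 + k)^-1 of k = i h. It has norm at most 1 because W is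
    isometric, and (1 + k)^2 (1 - e) = 1 + k^2 = 1 - h^2 = (1 + h) (1 - h), where
    (1 + k)^2 does not decrease norms. *)
Lemma contractive_of_selfadjoint h : star h = h -> exists2 e,
  `|e| <= 1 & forall x, `|x - e ** x| <= (1 + `|h|) * `|x - h ** x|.
Proof.
move=> hh; pose k := 'i *: h.
have kS : skew k by rewrite /skew starZ conjCi hh scaleNr.
have kk x : k ** (k ** x) = - (h ** (h ** x)).
  by rewrite !bmulZl bmulZr scalerA -expr2 sqrCi scaleN1r.
(* Solving (1 + k)^2 e = 2 k inside A keeps e in A. *)
have [f kf] := one_plus_surj k (k + k) kS.
have [e ke] := one_plus_surj k f kS.
have kke x : one_plus k (one_plus k (e ** x)) = k ** x + k ** x.
  by rewrite !one_plus_mul ke kf bmulDl.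
exists e => [|x].
  apply: norm_le_lmul => // x; rewrite mul1r.
  (* With x = (1 + k)^2 z, W^2 x = (1 - k)^2 z and 4 k z = x - W^2 x. *)
  have [y yx] := one_plus_surj k x kS.
  have [z zy] := one_plus_surj k y kS.
  have -> : e ** x = k ** z + k ** z.
    do 2 apply: (one_plus_inj _ kS).
    rewrite kke (one_plusD k (k ** z)) one_plus_comm zy (one_plusD k (k ** y)).
    by rewrite one_plus_comm yx.
  have -> : `|x| = `|one_plus (- k) (one_plus (- k) z)|.
    by rewrite norm_one_plusN// one_plusN_comm norm_one_plusN// zy yx.
  rewrite -(ler_pMn2r (ltn0Sn 1)) -normrMn.
  have -> : (k ** z + k ** z) *+ 2 =
      one_plus k (one_plus k z) - one_plus (- k) (one_plus (- k) z).
    have sub : one_plus k z - one_plus (- k) z = k ** z + k ** z.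
      by rewrite /one_plus bmulNl opprD opprK addrACA subrr add0r.
    have add : one_plus k z + one_plus (- k) z = z + z.
      by rewrite /one_plus bmulNl addrACA subrr addr0.
    rewrite (one_plusE k (one_plus k z)) (one_plusE (- k) (one_plus (- k) z)).
    rewrite bmulNl opprD opprK addrACA.
    by rewrite sub -[k ** one_plus k z + _]bmulDr add bmulDr mulr2n.
  apply: le_trans (ler_normB _ _) _.
  by rewrite zy yx norm_one_plusN// one_plusN_comm norm_one_plusN// zy yx mulr2n.
apply: le_trans (norm_one_plus_ge _ _ kS) _.
apply: le_trans (norm_one_plus_ge _ _ kS) _.
rewrite !one_plusB kke.
have -> : one_plus k (one_plus k x) - (k ** x + k ** x) =
    (x - h ** x) + h ** (x - h ** x).
  rewrite /one_plus bmulDr kk bmulBr [RHS]addrA subrK.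
  by rewrite [k ** x - _]addrC addrACA addrK.
apply: le_trans (ler_normD _ _) _; rewrite mulrDl mul1r lerD2l; exact: norm_bmul.
Qed.

(** The self-adjoint h with 1 - h = (1 - star e) (1 - e) has norm at most 8, and
    |(1 - h) a| <= 3 |(1 - e) a|: whence the factor 27 = (1 + 8) * 3. *)
Lemma contractive_approximate_unit (s : seq A) (eps : R[i]) : 0 < eps ->
  exists2 e, `|e| <= 1 & forall a, a \in s -> `|a - e ** a| <= eps.
Proof.
move=> eps0; have eps1 : 0 < eps / 27 by rewrite divr_gt0.
have [e eU es] := co_contractive_seq s _ eps1.
pose h := circ (star e) e.
have hh : star h = h.
  by rewrite /h /circ starD starN starM starD !starK [X in X - _]addrC.
have e2 := co_contractive_le2 _ eU.
have h8 : `|h| <= 8.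
  apply: le_trans (ler_normB _ _) _.
  have -> : 8 = (2 + 2) + 2 * 2 :> R[i] by ring.
  apply: lerD.
    by apply: le_trans (ler_normD _ _) _; rewrite norm_starE lerD.
  apply: le_trans (norm_bmul _ _) _; rewrite norm_starE.
  by apply: ler_pM.
have [f f1 fx] := contractive_of_selfadjoint _ hh.
exists f => // a /es ea; apply: le_trans (fx a) _.
have -> : eps = 9 * (3 * (eps / 27)) by field.
apply: ler_pM; rewrite ?addr_ge0//.
  have -> : 9 = 1 + 8 :> R[i] by ring.
  by rewrite lerD2l.
rewrite circE; apply: le_trans (ler_normB _ _) _.
have -> : 3 * (eps / 27) = eps / 27 + 2 * (eps / 27) by ring.
apply: lerD => //; apply: le_trans (norm_bmul _ _) _.
by rewrite norm_starE ler_pM.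
Qed.

End CstarAlgebra.

Section ApproximateUnit.
Context {R : realType} (A : cstarAlgType R).

(** The index set consists of the pairs of a finite list of elements and a
    precision. The precision is taken in R rather than R[i] so that any two have
    a minimum. *)
Definition approx_unit : set_system A :=
  filter_from [set p : seq A * R | 0 < p.2]
    (fun p => [set e : A | `|e| <= 1 /\
       forall a, a \in p.1 -> `|a - e ** a| <= (p.2)%:C%C]).

#[local] Instance approx_unit_filter : ProperFilter approx_unit.
Proof.
apply: filter_from_proper; last first.
  move=> [s eps] /= eps0.
  have [|e e1 es] := @contractive_approximate_unit _ A s eps%:C%C.
    by rewrite real_complex_gt0.
  by exists e.
apply: filter_from_filter => [|[s c] [t d] /= c0 d0].
  by exists ([::], 1) => /=.
exists (s ++ t, Num.min c d) => /=; first by rewrite lt_min c0.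
move=> e /= [e1 est]; split; split=> // a ast.
  apply: le_trans (est a _) _; first by rewrite mem_cat ast.
  by rewrite lecR ge_min lexx.
apply: le_trans (est a _) _; first by rewrite mem_cat ast orbT.
by rewrite lecR ge_min lexx orbT.
Qed.

Lemma approx_unit_le1 : \forall e \near approx_unit, `|e| <= 1.
Proof. by exists ([::], 1) => //= e []. Qed.

Lemma approx_unit_cvg (a : A) : (fun e => e ** a) @ approx_unit --> a.
Proof.
apply/cvgrPdist_le => eps eps0.
exists ([:: a], complex.Re eps) => /=.
  by have := eps0; rewrite {1}(ge0_ReE (ltW eps0)) real_complex_gt0.
by move=> e [_ ea]; rewrite (ge0_ReE (ltW eps0)) ea ?inE.
Qed.

End ApproximateUnit.

(** * Non-degenerate actions *)

Lemma norm_cvg_le {R : realType} {V : normedModType R[i]} {T : Type}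
    {F : set_system T} {FF : ProperFilter F} (f : T -> V) (l : V) (M : R[i]) :
  f @ F --> l -> (\forall t \near F, `|f t| <= M) -> `|l| <= M.
Proof.
move=> fl fM; apply/ler_addgt0Pr => eps eps0.
have [t [ft lt]] := filter_ex (filterI fM (cvgr_dist_le _ _ fl _ eps0)).
rewrite -[l](subrK (f t)) addrC; apply: le_trans (ler_normD _ _) _.
exact: lerD.
Qed.

Lemma bopB {R : realType} {V : completeNormedModType R[i]} (f : boundedOp V) x y :
  f (x - y) = f x - f y.
Proof. by rewrite bopD -scaleN1r bopZ scaleN1r. Qed.

Section NondegenerateActions.
Context {R : realType} {A : cstarAlgType R} {X : completeNormedModType R[i]}.
Context (pi : isometricAction A X) (pi_nondeg : nondegenerate_action pi).

Local Existing Instance approx_unit_filter.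

Lemma nondegenerate_approx (x : X) (d : R[i]) : 0 < d ->
  exists (n : nat) (a : 'I_n -> A) (y : 'I_n -> X),
    `|x - \sum_(i < n) pi (a i) (y i)| < d.
Proof.
move=> d0; have [||z [xz [n [a [y zE]]]]] := pi_nondeg (ball x d).
- by exists x; exact: ballxx.
- exact: ball_open.
by exists n, a, y; move: xz; rewrite zE -ball_normE.
Qed.

(** The difference of b and c vanishes on the span of the vectors pi a y, which is
    dense. *)
Lemma nondegenerate_ext (b c : boundedOp X) :
  (forall a, b ** pi a = c ** pi a) -> b = c.
Proof.
move=> bc; apply: bop_ext => x; apply/eqP; rewrite -subr_eq0 -normr_le0.
apply/ler_addgt0Pr => eps eps0; rewrite add0r.
have N0 : 0 < `|b - c| + 1 by rewrite ltr_wpDl.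
have [n [a [y xy]]] := nondegenerate_approx x _ (divr_gt0 eps0 N0).
set z := \sum_(i < n) _ in xy.
have z0 : (b - c) z = 0.
  rewrite /z; elim/big_ind: _ => [|u v u0 v0|i _]; first exact: bop0.
    by rewrite bopD u0 v0 addr0.
  by rewrite -bop_mulE bmulBl bc subrr.
have -> : b x - c x = (b - c) (x - z).
  by rewrite bopB z0 subr0.
apply: le_trans (bop_norm_ub _ _) _.
apply: (@le_trans _ _ ((`|b - c| + 1) * `|x - z|)).
  by rewrite ler_wpM2r// lerDl.
by rewrite mulrC -ler_pdivlMr// ltW.
Qed.

(** b is the strong limit of pi (Phi e) along the approximate unit. Its norm is
    at most |Phi| because |Phi e| <= |Phi| |e| <= |Phi|. *)
Lemma left_centralizer_extension (Phi : boundedOp A) : LC_set Phi ->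
  exists2 b : boundedOp X, `|b| <= `|Phi| & forall a, b ** pi a = pi (Phi a).
Proof.
move=> PhiLC; pose F := approx_unit A; pose G x e := pi (Phi e) x.
have Gle x : \forall e \near F, `|G x e| <= `|Phi| * `|x|.
  apply: filterS (approx_unit_le1 A) => e e1.
  apply: le_trans (bop_norm_ub _ _) _; rewrite ler_wpM2r// act_norm.
  by apply: le_trans (bop_norm_ub _ _) _; rewrite ler_piMr.
(* Phi e ** a = Phi (e ** a): this is where Phi being a centralizer enters. *)
have Gact a x : G (pi a x) @ F --> pi (Phi a) x.
  have -> : G (pi a x) = (fun c => pi (Phi c) x) \o (fun e => e ** a).
    by apply/funext => e; rewrite /G /= PhiLC act_mul.
  suff Gc : continuous (fun c => pi (Phi c) x).
    exact: (cvg_comp _ _ (approx_unit_cvg A a) (Gc a)).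
  apply: (@lipschitz_cont _ _ _ _ (`|Phi| * `|x|)) => [|c d]; first exact: mulr_ge0.
  have -> : pi (Phi c) x - pi (Phi d) x = pi (Phi (c - d)) x.
    by rewrite bopB actB.
  apply: le_trans (bop_norm_ub _ _) _; rewrite act_norm mulrAC ler_wpM2r//.
  exact: bop_norm_ub.
have Gsum n (a : 'I_n -> A) (y : 'I_n -> X) :
    G (\sum_(i < n) pi (a i) (y i)) @ F --> \sum_(i < n) pi (Phi (a i)) (y i).
  elim/big_rec2: _ => [|i z l _ zl].
    have -> : G 0 = cst 0 by apply/funext => e; exact: bop0.
    exact: cvg_cst.
  have -> : G (pi (a i) (y i) + l) = G (pi (a i) (y i)) \+ G l.
    by apply/funext => e; exact: bopD.
  exact: cvgD.
(* Approximating x by a vector z of the span moves G x by less than eps / 2,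
   uniformly along the filter. *)
have Gcvg x : cvg (G x @ F).
  apply: cauchy_cvg; apply: cauchy_exP => eps eps0.
  have N0 : 0 < `|Phi| + 1 by rewrite ltr_wpDl.
  have eps2 : 0 < eps / 2 by rewrite divr_gt0.
  have [n [a [y xy]]] := nondegenerate_approx x _ (divr_gt0 eps2 N0).
  set z := \sum_(i < n) _ in xy.
  exists (\sum_(i < n) pi (Phi (a i)) (y i)).
  suff : \forall e \near F, ball (\sum_(i < n) pi (Phi (a i)) (y i)) eps (G x e).
    by [].
  near=> e; rewrite -ball_normE /= -(subrKA (G z e)).
  apply: le_lt_trans (ler_normD _ _) _; rewrite [eps]splitr; apply: ltrD.
    by near: e; exact: (cvgr_dist_lt _ _ (Gsum n a y)).
  have -> : G z e - G x e = G (z - x) e.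
    by rewrite /G bopB.
  apply: (@le_lt_trans _ _ (`|Phi| * `|z - x|)); first by near: e; exact: Gle.
  apply: (@le_lt_trans _ _ ((`|Phi| + 1) * `|z - x|)).
    by rewrite ler_wpM2r// lerDl.
  by rewrite mulrC -ltr_pdivlMr// distrC.
pose g x := lim (G x @ F).
have gE x : G x @ F --> g x by exact: Gcvg.
have g_le x : `|g x| <= `|Phi| * `|x| by exact: norm_cvg_le (gE x) (Gle x).
have gb : g \in bounded_linear_pred X.
  apply/asboolP; split; last by exists `|Phi|.
  move=> k x y; apply: (cvg_unique (@norm_hausdorff _ X) (gE _)).
  have -> : G (k *: x + y) = (fun e => k *: G x e + G y e).
    by apply/funext => e; rewrite /G bop_linear.
  by apply: cvgD; [exact: cvgZr (gE x)|exact: gE].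
exists (BoundedOp gb).
  by apply: bop_norm_le => //; exact: normr_ge0.
move=> a; apply: bop_ext => x.
exact: (cvg_unique (@norm_hausdorff _ X) (gE _) (Gact a x)).
Unshelve. all: by end_near. Qed.

End NondegenerateActions.

Theorem proposition3p3 (R : realType) (A : cstarAlgType R)
    (X : completeNormedModType R[i]) (pi : isometricAction A X)
    (pi_nondeg : nondegenerate_action pi) :
  isometric_banach_alg_iso (leftMul pi).
Proof.
have Linj : injective (leftMul pi).
  move=> b c bc; apply: csa_ext; apply: (nondegenerate_ext _ pi_nondeg) => a.
  by rewrite -!leftMulE bc.
have Lsurj (Phi : LC A) : exists b : LM (act_range pi),
    leftMul pi b = Phi /\ `|b| <= `|Phi|.
  have [b b_le bE] := left_centralizer_extension _ pi_nondeg _ (csaP Phi).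
  have bLM : LM_set (act_range pi) b.
    by move=> _ [a _ <-]; rewrite bE; exists (csa_val Phi a).
  exists (@csa_elt _ _ (LM (act_range pi)) _ bLM); split => //.
  apply: csa_ext; apply: bop_ext => a; apply: (@act_inj _ _ _ pi).
  by rewrite leftMulE -bE.
have [inv invE] := choice Lsurj.
split.
- move=> k b c; apply: csa_ext; apply: bop_ext => a; apply: (@act_inj _ _ _ pi).
  rewrite leftMulE bopDE bopZE act_linear !leftMulE.
  by rewrite -bmulZl -bmulDl.
- move=> b c; apply: csa_ext; apply: bop_ext => a; apply: (@act_inj _ _ _ pi).
  by rewrite leftMulE csa_valM bop_mulE !leftMulE -bmulA.
- move=> b; apply/le_anti/andP; split.
    apply: bop_norm_le => // a.
    by rewrite -(act_norm pi) leftMulE -(act_norm pi a) norm_bmul.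
  (* The preimage of L_b of norm at most |L_b| can only be b. *)
  by have [/Linj ->] := invE (leftMul pi b).
- exists inv => [b|Phi]; last exact: (invE Phi).1.
  by apply: Linj; exact: (invE _).1.
Qed.
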